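(* Let $r\ge 2$ be an integer and let $G$ be a simple graph on $n$ vertices with $c_r(G)$ $r$-cliques. Then $$c_r(G)\le \frac{n}{r}\,\rho_r(G).$$ Furthermore, if the number of $r$-cliques containing $i$ is the same for every vertex $i$ of $G$, then equality holds.
   Context: Graphs are finite, simple and undirected with vertex set $\{1,\dots,n\}$. An $r$-clique is a set of $r$ vertices inducing a complete subgraph; $C_r(G)$ is the set of $r$-cliques of $G$ and $c_r(G)=|C_r(G)|$. The $r$-clique tensor of $G$ is the order-$r$, dimension-$n$ tensor $\mathcal{A}(G)=(a_{i_1\cdots i_r})$ with $a_{i_1\cdots i_r}=\frac{1}{(r-1)!}$ if $\{i_1,\dots,i_r\}\in C_r(G)$ and $0$ otherwise. For an order-$m$ dimension-$n$ tensor $\mathcal{A}$ and $x\in\mathbb{C}^n$, $\mathcal{A}x^{m-1}$ is the vector with $i$-th component $\sum_{i_2,\dots,i_m=1}^n a_{ii_2\cdots i_m}x_{i_2}\cdots x_{i_m}$; $\lambda\in\mathbb{C}$ is an eigenvalue if $\mathcal{A}x^{m-1}=\lambda x^{[m-1]}$ for some nonzero $x$, where $x^{[m-1]}=(x_1^{m-1},\dots,x_n^{m-1})^T$. The spectral radius $\rho(\mathcal{A})$ is the maximum modulus of eigenvalues, and $\rho_r(G):=\rho(\mathcal{A}(G))$. *)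

(* Defs.v *)
From mathcomp Require Import all_boot all_order all_algebra.
From mathcomp Require Import classical_sets reals.
From mathcomp Require Export complex.

Set Implicit Arguments.
Unset Strict Implicit.
Unset Printing Implicit Defensive.

Import Order.TTheory GRing.Theory Num.Theory.

Local Open Scope ring_scope.

Record sgraph (n : nat) := SGraph {
  edge : rel 'I_n;
  edge_sym : symmetric edge;
  edge_irrefl : irreflexive edge
}.

Definition cliques (n : nat) (G : sgraph n) (r : nat) : {set {set 'I_n}} :=
  [set S : {set 'I_n} | (#|S| == r) &&
    [forall i in S, forall j in S, (i != j) ==> edge G i j]].

Definition num_cliques (n : nat) (G : sgraph n) (r : nat) : nat :=
  #|cliques G r|.

Definition num_cliques_at (n : nat) (G : sgraph n) (r : nat) (i : 'I_n) : nat :=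
  #|[set S in cliques G r | i \in S]|.

Definition tensor (F : Type) (m n : nat) := {ffun m.-tuple 'I_n -> F}.

(* The [i]-th component of A x^(m-1).  The index tuple t = (i_1, ..., i_m)
   ranges over those with i_1 = i, and [behead t] is (i_2, ..., i_m).
   This is intended for m >= 1: there are no such tuples when m = 0. *)
Definition tensor_apply (F : pzRingType) (m n : nat) (A : tensor F m n)
    (x : 'cV[F]_n) : 'cV[F]_n :=
  \col_i \sum_(t : m.-tuple 'I_n | ohead t == Some i)
           A t * \prod_(j <- behead t) x j ord0.

Definition tensor_eigenvalue (F : pzRingType) (m n : nat) (A : tensor F m n)
    (lambda : F) : Prop :=
  exists2 x : 'cV[F]_n, x != 0 &
    tensor_apply A x = lambda *: map_mx (fun a : F => a ^+ m.-1) x.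

Definition eigenvalue_moduli (R : realType) (m n : nat) (A : tensor R[i] m n) :
    set R :=
  [set s : R | exists2 lambda : R[i], tensor_eigenvalue A lambda &
                 s = ComplexField.Normc.normc lambda]%classic.

(* As a total real-valued function the maximum is rendered by [sup], which is
   the maximum as soon as there is one: see [spectral_radius_max] below. *)
Definition spectral_radius (R : realType) (m n : nat) (A : tensor R[i] m n) : R :=
  sup (eigenvalue_moduli A).

Lemma spectral_radius_max (R : realType) (m n : nat) (A : tensor R[i] m n)
    (s : R) :
  eigenvalue_moduli A s -> (forall t, eigenvalue_moduli A t -> t <= s) ->
  spectral_radius A = s.
Proof.
move=> As s_max; apply/eqP; rewrite eq_le; apply/andP; split.
  by apply: ge_sup => //; exists s.
by apply: ub_le_sup => //; exists s.
Qed.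

(* The index tuples t run over all of 'I_n^r, repetitions included; a tuple
   with a repetition has a support of fewer than r vertices, hence entry 0. *)
Definition clique_tensor (F : fieldType) (n : nat) (G : sgraph n) (r : nat) :
    tensor F r n :=
  [ffun t : r.-tuple 'I_n =>
     if [set i in t] \in cliques G r then ((r.-1)`!%:R)^-1 else 0].

Definition clique_spectral_radius (R : realType) (n : nat) (G : sgraph n)
    (r : nat) : R :=
  spectral_radius (clique_tensor R[i] G r).

(* Main.v *)
(** The clique tensor maps x to the gradient of the edge sum
    P(x) = sum over cliques S of prod_(i in S) x_i.  Comparing moduli at a
    coordinate of largest modulus bounds every eigenvalue by the maximum clique
    degree.  Conversely, let x maximise P over the nonnegative x with
    sum x_i^r = 1; by homogeneity P(y) <= P(x) * sum y_i^r for all y >= 0.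
    Stationarity along each coordinate makes x an eigenvector for r P(x), and
    y = (1, ..., 1) gives c_r <= n P(x), which is the stated inequality.  If all
    clique degrees equal d, then rho <= d and n d = r c_r give equality. *)

Require Import Defs.
From mathcomp Require Import all_boot all_order all_algebra.
From mathcomp Require Import all_classical all_reals all_analysis.
From mathcomp Require Import ring lra.

Set Implicit Arguments.
Unset Strict Implicit.
Unset Printing Implicit Defensive.

Import Order.TTheory GRing.Theory Num.Theory.
Import numFieldNormedType.Exports.

Local Open Scope ring_scope.

(** * Index tuples with a prescribed first entry *)

Lemma sum_tuple_head (T : finType) (V : nmodType) (k : nat) (i : T)
    (f : k.+1.-tuple T -> V) :
  \sum_(t : k.+1.-tuple T | ohead t == Some i) f t =
  \sum_(u : k.-tuple T) f [tuple of i :: u].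
Proof.
rewrite (reindex_onto (fun u : k.-tuple T => [tuple of i :: u])
  (fun t => [tuple of behead t])) /=; last first.
  move=> t; case/tupleP: t => j t /= /eqP[->]; apply: val_inj => /=.
  by congr (_ :: _).
by apply: eq_bigl => u; rewrite eqxx /=; apply/eqP/val_inj.
Qed.

(** A tuple with [k.+1] entries and [k.+1] distinct values has no repetition, so [u] must list
    [S :\ i] without repetition. In this form the tuples supported on a given clique can be
    counted. *)
Lemma set_cons_tuple_eq (T : finType) (k : nat) (i : T) (u : k.-tuple T)
    (S : {set T}) : #|S| = k.+1 ->
  ([set j in i :: u] == S) = (i \in S) && (all (mem (S :\ i)) u && uniq u).
Proof.
move=> Sk; apply/eqP/idP => [uS | /and3P[iS uSi u_uniq]].
  have : uniq (i :: u).
    by apply/card_uniqP; rewrite /= size_tuple -Sk -uS cardsE.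
  rewrite /= => /andP[iu ->]; rewrite andbT -uS inE mem_head /=.
  apply/allP => j ju; rewrite /= !inE ju orbT andbT.
  by apply: contraNneq iu => <-.
have iu : i \notin u.
  by apply/negP => /(allP uSi); rewrite /= !inE eqxx.
apply/eqP; rewrite eqEcard; apply/andP; split.
  apply/fintype.subsetP => j; rewrite !inE => /orP[/eqP-> //|/(allP uSi)].
  by rewrite /= !inE => /andP[].
by rewrite cardsE Sk (card_uniqP _) /= ?iu // size_tuple.
Qed.

(** * Edge polynomials of uniform hypergraphs *)

Section UniformHypergraph.
Variables (n : nat) (H : {set {set 'I_n}}).

Definition edge_sum (F : comPzRingType) (x : 'I_n -> F) : F :=
  \sum_(S in H) \prod_(j in S) x j.

(** The partial derivative of [edge_sum] in the coordinate [i]. *)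
Definition link_sum (F : comPzRingType) (x : 'I_n -> F) (i : 'I_n) : F :=
  \sum_(S in H | i \in S) \prod_(j in S :\ i) x j.

(** Double counting of the pairs formed by an edge and one of its vertices. *)
Lemma sum_degree (r : nat) :
  (forall S, S \in H -> #|S| = r) ->
  (\sum_(i < n) #|[set S in H | i \in S]| = r * #|H|)%N.
Proof.
move=> Hr.
rewrite (eq_bigr (fun i : 'I_n => \sum_(S in H | i \in S) 1%N)); last first.
  by move=> i _; rewrite -sum1_card; apply: eq_bigl => S; rewrite inE.
rewrite (exchange_big_dep (mem H)) /=; last by move=> i S _ /andP[].
rewrite mulnC -sum_nat_const; apply: eq_bigr => S HS.
by rewrite sum1dep_card -(Hr S HS) HS; apply: eq_card => i; rewrite inE.
Qed.

(** [edge_sum] is affine in each single coordinate, since an edge contains [i] at most once; hence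
    the first-order expansion is exact. *)
Lemma edge_sum_update (F : comPzRingType) (x y : 'I_n -> F) (i : 'I_n) :
  (forall j, j != i -> y j = x j) ->
  edge_sum y - edge_sum x = link_sum x i * (y i - x i).
Proof.
move=> xy; rewrite /edge_sum /link_sum.
rewrite (bigID (fun S : {set 'I_n} => i \in S) _ (fun S => \prod_(j in S) y j)).
rewrite (bigID (fun S : {set 'I_n} => i \in S) _ (fun S => \prod_(j in S) x j)).
rewrite /= [X in _ + X - _](_ : _ =
    \sum_(S in H | i \notin S) \prod_(j in S) x j); last first.
  apply: eq_bigr => S /andP[_ iS]; apply: eq_bigr => j jS; apply: xy.
  by apply: contraNneq iS => <-.
rewrite opprD addrACA subrr addr0 -sumrB mulr_suml.
apply: eq_bigr => S /andP[_ iS].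
rewrite (big_setD1 i iS) [X in _ - X](big_setD1 i iS) /= mulrBr mulrC.
congr (_ * _ - _); last by rewrite mulrC.
by apply: eq_bigr => j; rewrite !inE => /andP[ji _]; exact: xy.
Qed.

(** Each edge through [i] contributes a product of [r.-1] factors, all bounded by the largest
    modulus. *)
Lemma link_sum_norm_le (F : numDomainType) (r : nat) (x : 'I_n -> F) (i : 'I_n) :
  (forall S, S \in H -> #|S| = r) -> (forall j, `|x j| <= `|x i|) ->
  `|link_sum x i| <= #|[set S in H | i \in S]|%:R * `|x i| ^+ r.-1.
Proof.
move=> Hr xi; apply: le_trans (ler_norm_sum _ _ _) _.
rewrite mulr_natl -sumr_const [leRHS](eq_bigl (fun S => (S \in H) && (i \in S)));
  last by move=> S; rewrite inE.
apply: ler_sum => S /andP[HS iS].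
rewrite normr_prod -(Hr S HS) (cardsD1 i S) iS /= -prodr_const.
by apply: ler_prod => j _; rewrite normr_ge0 xi.
Qed.

Lemma edge_sumZ (F : comPzRingType) (r : nat) (c : F) (x : 'I_n -> F) :
  (forall S, S \in H -> #|S| = r) ->
  edge_sum (fun i => c * x i) = c ^+ r * edge_sum x.
Proof.
move=> Hr; rewrite mulr_sumr; apply: eq_bigr => S /Hr Sr.
by rewrite big_split /= prodr_const Sr.
Qed.

End UniformHypergraph.

(** * The clique tensor as a gradient *)

Lemma tensor_apply_clique (F : numFieldType) (n r : nat) (G : sgraph n)
    (x : 'cV[F]_n) (i : 'I_n) :
  (0 < r)%N ->
  tensor_apply (clique_tensor F G r) x i ord0 =
  link_sum (cliques G r) (fun j => x j ord0) i.
Proof.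
case: r => // k _; rewrite mxE sum_tuple_head /link_sum.
pose a : F := (k`!%:R)^-1.
(* The support of [i :: u] is at most one clique, so the entry can be written as a sum over all
   cliques [S]; the two sums are then exchanged. *)
transitivity (\sum_(u : k.-tuple 'I_n) \sum_(S in cliques G k.+1)
    if [set j in i :: u] == S then a * \prod_(j <- u) x j ord0 else 0).
  apply: eq_bigr => u _; rewrite ffunE.
  rewrite -big_mkcondr /=; case: ifPn => [uG | /negP uG].
    rewrite (big_pred1 [set j in i :: u]) // => S /=; rewrite eq_sym.
    by case: eqP => [->|]; rewrite ?uG ?andbF.
  by rewrite mul0r big_pred0 // => S; apply/negP => /andP[/[swap]/eqP<-].
rewrite exchange_big [RHS]big_mkcondr /=; apply: eq_bigr => S.
rewrite inE => /andP[/eqP Sk _].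
under eq_bigr => u _ do rewrite set_cons_tuple_eq //.
case: ifPn => iS /=; last by rewrite big1.
rewrite -big_mkcond /=.
have Sik : #|S :\ i| = k by have := cardsD1 i S; rewrite iS Sk => -[->].
rewrite (eq_bigr (fun=> a * \prod_(j in S :\ i) x j ord0)); last first.
  move=> u /andP[/allP uS u_uniq]; congr (_ * _).
  rewrite (big_uniq _ u_uniq) /=; apply: eq_bigl.
  apply/subset_cardP; first by rewrite (card_uniqP u_uniq) size_tuple.
  by apply/fintype.subsetP.
have card_u : #|[pred u : k.-tuple 'I_n | all (mem (S :\ i)) u && uniq u]| = k`!.
  transitivity (#|S :\ i| ^_ k)%N; last by rewrite Sik ffactnn.
  by rewrite -card_uniq_tuples; apply: eq_card => u; rewrite !inE.
rewrite sumr_const card_u -mulr_natl mulrA divff ?mul1r //.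
Qed.

(** * Stationarity in one variable *)

Lemma stationary_monomial (R : realType) (r : nat) (g M x : R) :
  (2 <= r)%N -> 0 <= g -> 0 <= x ->
  (forall s, 0 <= s -> g * (s - x) <= M * (s ^+ r - x ^+ r)) ->
  g = r%:R * M * x ^+ r.-1.
Proof.
move=> r2 g0; rewrite le_eqVlt => /predU1P[<-|x0] gM.
  have r0 : (0 < r)%N := ltnW r2.
  (* At the boundary point 0 the claim reads [g = 0], because [r.-1] is positive. No two-sided
     derivative is available, so [0 < g] is refuted by a small [s]. *)
  rewrite expr0n -subn1 subn_eq0 leqNgt r2 mulr0; apply/eqP.
  rewrite eq_le g0 andbT leNgt; apply/negP => g_gt0.
  (* Comparison at 1 gives [g <= M]: thus [M] is positive and the point [s] chosen below is at most
     1. *)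
  have := gM 1 ler01; rewrite expr1n expr0n gtn_eqF // !subr0 !mulr1 => gM1.
  have M0 : 0 < M := lt_le_trans g_gt0 gM1.
  (* At this s one has g * s <= M * s ^+ r <= M * s ^+ 2 = g * s / 2. *)
  pose s := g / (2 * M).
  have s0 : 0 < s by rewrite divr_gt0 // mulr_gt0.
  have s1 : s <= 1 by rewrite ler_pdivrMr ?mulr_gt0 //; lra.
  have := gM s (ltW s0); rewrite expr0n gtn_eqF // !subr0.
  have Ms : 2 * (M * s) = g by rewrite /s; field; rewrite gt_eqF.
  have : s ^+ r <= s ^+ 2 by rewrite ler_wiXn2l // ltW.
  nra.
(* For [x] positive, [f] has a minimum at the midpoint of the open interval from 0 to [x + x], so
   its derivative vanishes there. *)
pose f : R -> R := (M \*: (@id R) ^+ r - g \*: (@id R)).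
have fE t : f t = M * t ^+ r - g * t by rewrite /f !fctE.
have df (t : R) : is_derive t 1 f (M * (r%:R * t ^+ r.-1) - g).
  by apply: is_derive_eq; rewrite /= /GRing.scale /= !mulr1.
have fmin t : t \in `]0, x + x[%R -> f x <= f t.
  by rewrite in_itv /= !fE => /andP[/ltW/gM + _]; lra.
have xx : x \in `]0, x + x[%R by rewrite in_itv /= x0 ltrDl x0.
have f_derivable t : t \in `]0, x + x[%R -> derivable f t 1.
  by move=> _; exact: (@ex_derive _ _ _ _ _ _ _ (df t)).
have [_] := derive1_at_min (ltW (addr_gt0 x0 x0)) f_derivable xx fmin.
rewrite (@derive_val _ _ _ _ _ _ _ (df x)); lra.
Qed.

(** * Maximising the edge polynomial *)

Section Maximizer.
Variables (R : realType) (n : nat) (H : {set {set 'I_n}}) (r : nat).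
Hypothesis H_uniform : forall S, S \in H -> #|S| = r.

Lemma edge_sum_continuous :
  continuous (fun x : 'rV[R]_n => edge_sum H (x ord0)).
Proof.
apply: continuous_big => [|S _]; first exact: add_continuous.
apply: continuous_big => [|j _]; first exact: mul_continuous.
exact: coord_continuous.
Qed.

Lemma power_sum_continuous :
  continuous (fun x : 'rV[R]_n => \sum_i x ord0 i ^+ r).
Proof.
apply: continuous_big => [|i _ x]; first exact: add_continuous.
apply: (@continuous_comp _ _ _ (fun v : 'rV[R]_n => v ord0 i) (fun t => t ^+ r)).
  exact: coord_continuous.
exact: exprn_continuous.
Qed.

Lemma exists_maximizer :
  (0 < n)%N -> (0 < r)%N ->
  exists x : 'I_n -> R, [/\ forall i, 0 <= x i, \sum_i x i ^+ r = 1 &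
    forall y, (forall i, 0 <= y i) ->
      edge_sum H y <= edge_sum H x * \sum_i y i ^+ r].
Proof.
move=> n0 r0.
(* Nonnegative coordinates whose [r]-th powers sum to 1 are at most 1, so the cube imposes
   nonnegativity alone while making the domain compact. *)
pose cube : set 'rV[R]_n := [set v | forall i, `[0, 1]%classic (v ord0 i)]%classic.
pose sphere : set 'rV[R]_n := [set v | \sum_i v ord0 i ^+ r = 1]%classic.
have cK : compact (cube `&` sphere)%classic.
  apply: compact_closedI.
    apply: (@rV_compact R n (fun=> `[0, 1]%classic)) => i.
    exact: segment_compact.
  apply: (@preimage_closed _ _ (fun v : 'rV[R]_n => \sum_i v ord0 i ^+ r)
    [set x | x = 1]%classic); last exact: closed_eq.
  by move=> v _; exact: power_sum_continuous.
have K0 : (cube `&` sphere !=set0)%classic.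
  pose i0 := Ordinal n0.
  exists (delta_mx ord0 i0); split=> [i|] /=.
    by rewrite mxE in_itv /= ler0n lern1 leq_b1.
  rewrite /sphere /= (bigD1 i0) //= mxE !eqxx expr1n big1 ?addr0 // => i ii0.
  by rewrite mxE (negPf ii0) andbF expr0n gtn_eqF.
have [x /set_mem[xcube xsphere] xmax] := EVT_max_rV K0 cK
  (continuous_subspaceT edge_sum_continuous).
exists (x ord0); split=> // [i|y y0].
  by have := xcube i; rewrite /= in_itv /= => /andP[].
pose p := \sum_i y i ^+ r.
have yp i : y i ^+ r <= p.
  by rewrite /p (bigD1 i) //= lerDl sumr_ge0 // => j _; rewrite exprn_ge0.
(* If [p] is 0, then [y] cannot be normalised; but then [y] vanishes, and so does every monomial,
   edges being nonempty. *)
have [p0|p_neq0] := eqVneq p 0.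
  rewrite -/p p0 mulr0 /edge_sum big1 // => S HS.
  have /card_gt0P[i iS] : (0 < #|S|)%N by rewrite H_uniform.
  rewrite (bigD1 i) //=.
  have := yp i; rewrite p0 => yi.
  have /eqP : y i ^+ r == 0 by rewrite eq_le yi exprn_ge0.
  by move/eqP; rewrite expf_eq0 r0 /= => /eqP->; rewrite mul0r.
have p_gt0 : 0 < p.
  by rewrite lt_def p_neq0 sumr_ge0 // => i _; rewrite exprn_ge0.
(* Dividing [y] by the [r]-th root of [p] makes its power sum 1; homogeneity then carries the
   maximality of [x] back to [y]. *)
pose c : R := p `^ (r%:R^-1).
have cr : c ^+ r = p.
  rewrite /c -powR_mulrn ?powR_ge0 // -powRrM mulVf ?pnatr_eq0 -?lt0n //.
  by rewrite powRr1 // ltW.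
have c_gt0 : 0 < c by rewrite powR_gt0.
pose z : 'rV[R]_n := \row_i (c^-1 * y i).
have zE : edge_sum H (z ord0) = p^-1 * edge_sum H y.
  rewrite -cr -exprVn -(edge_sumZ _ _ H_uniform).
  by congr (edge_sum _ _); apply/funext => i; rewrite mxE.
have zK : z \in (cube `&` sphere)%classic.
  apply/mem_set; split => [i|].
    rewrite /= mxE in_itv /= mulr_ge0 ?invr_ge0 ?(ltW c_gt0) //=.
    by rewrite ler_pdivrMl // mulr1 -(ler_pXn2r r0) ?nnegrE ?(ltW c_gt0) ?cr.
  rewrite /sphere /=; under eq_bigr => i _ do rewrite mxE exprMn.
  by rewrite -mulr_sumr exprVn cr mulVf.
by have := xmax _ zK; rewrite zE mulrC ler_pdivrMr.
Qed.

(** A maximiser [x] supplies everything, with [lambda] equal to [r] times the maximum [M]; this is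
    the Lagrange multiplier condition, obtained one coordinate at a time. *)
Lemma exists_nonneg_eigenvector :
  (0 < n)%N -> (2 <= r)%N ->
  exists lambda : R, exists x : 'I_n -> R,
    [/\ 0 <= lambda, #|H|%:R * r%:R <= lambda * n%:R, exists i, x i != 0 &
        forall i, link_sum H x i = lambda * x i ^+ r.-1].
Proof.
move=> n0 r2; have r0 : (0 < r)%N := ltnW r2.
have [x [x0 x1 xmax]] := exists_maximizer n0 r0.
pose M := edge_sum H x; exists (r%:R * M), x; split.
- by rewrite mulr_ge0 // sumr_ge0 // => S _; rewrite prodr_ge0.
(* At the all-ones vector every monomial is 1 and the power sum is [n]. *)
- have := xmax (fun=> 1) (fun=> ler01).
  under eq_bigr => i _ do rewrite expr1n.
  rewrite sumr_const card_ord /edge_sum.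
  under eq_bigr => S _ do rewrite big1_eq.
  rewrite sumr_const -/M => HM.
  by rewrite mulrC -mulrA ler_wpM2l.
- apply: contrapT => /forallNP xz.
  move: x1; rewrite big1 => [/eqP|i _]; first by rewrite eq_sym oner_eq0.
  by have /negP := xz i; rewrite negbK => /eqP->; rewrite expr0n gtn_eqF.
move=> i; apply: stationary_monomial => //.
  by rewrite sumr_ge0 // => S _; rewrite prodr_ge0.
(* Only the coordinate [i] is moved. The edge sum changes by [link_sum H x i] times [s - x i], the
   power sum by [s ^+ r - x i ^+ r], and maximality compares the two changes. *)
move=> s s0; pose y j := if j == i then s else x j.
have y0 j : 0 <= y j by rewrite /y; case: eqP.
have yx j : j != i -> y j = x j by rewrite /y => /negPf->.
have yi : y i = s by rewrite /y eqxx.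
rewrite -yi -(edge_sum_update _ yx) -/M.
have -> : y i ^+ r - x i ^+ r = \sum_j y j ^+ r - 1.
  rewrite -x1 [X in _ = X - _](bigD1 i) // [X in _ = _ - X](bigD1 i) //=.
  rewrite opprD addrACA [X in _ = _ + (X - _)](eq_bigr (fun j => x j ^+ r));
    last by move=> j /yx->.
  by rewrite subrr addr0.
by rewrite mulrBr mulr1 lerD2r xmax.
Qed.

End Maximizer.

(** * Eigenvalues of the clique tensor *)

Section CliqueSpectralRadius.
Variables (R : realType) (n : nat) (G : sgraph n) (r : nat).

Lemma cliques_card S : S \in cliques G r -> #|S| = r.
Proof. by rewrite inE => /andP[/eqP]. Qed.

(** Links the real-valued modulus used for the spectral radius with the norm of [R[i]], whose values
    are complex. *)
Lemma normc_norm (z : R[i]) : (ComplexField.Normc.normc z)%:C%C = `|z|.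
Proof. by case: z. Qed.

Lemma clique_eigenvalue_moduli_ub (d : nat) :
  (0 < r)%N -> (forall i, num_cliques_at G r i <= d)%N ->
  ubound (eigenvalue_moduli (clique_tensor R[i] G r)) d%:R.
Proof.
move=> r0 deg_le s [lambda [x x_neq0 /matrixP Ax] ->].
have [i0 xi0] : exists i, x i ord0 != 0.
  apply: contrapT => /forallNP xz; case/eqP: x_neq0; apply/matrixP => i j.
  by rewrite mxE (ord1 j); have /negP := xz i; rewrite negbK => /eqP.
(* The maximum is taken over real moduli, as the order on [R[i]] is only partial. The eigenvalue
   equation at [i] is then divided by the positive number [|x i| ^+ r.-1]. *)
pose i := [arg max_(k > i0) ComplexField.Normc.normc (x k ord0)]%O.
have xi j : `|x j ord0| <= `|x i ord0|.
  rewrite -!normc_norm lecR /i.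
  by case: arg_maxP => // k _; exact.
have xi_gt0 : 0 < `|x i ord0| by apply: lt_le_trans (xi i0); rewrite normr_gt0.
have := link_sum_norm_le cliques_card xi.
rewrite -tensor_apply_clique // Ax !mxE normrM normrX.
rewrite ler_pM2r ?exprn_gt0 // => lambda_le.
rewrite -lecR normc_norm rmorph_nat; apply: le_trans lambda_le _.
by rewrite ler_nat deg_le.
Qed.

(** The real nonnegative eigenpair given by the maximiser stays an eigenpair over [R[i]], and the
    modulus of its eigenvalue is the eigenvalue itself. *)
Lemma exists_large_clique_modulus :
  (0 < n)%N -> (2 <= r)%N ->
  exists2 s : R, eigenvalue_moduli (clique_tensor R[i] G r) s &
    (num_cliques G r)%:R <= n%:R / r%:R * s.
Proof.
move=> n0 r2.
have [lambda [x [lambda0 Hlambda [i xi] Ax]]] :=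
  exists_nonneg_eigenvector R cliques_card n0 r2.
exists lambda; last first.
  rewrite mulrAC ler_pdivlMr ?ltr0n 1?ltnW // [n%:R * _]mulrC.
  exact: Hlambda.
exists lambda%:C%C.
  exists (\col_j (x j)%:C%C).
    apply: contra_neq xi => /matrixP/(_ i ord0); rewrite !mxE => /eqP.
    by rewrite (inj_eq (@complexI R)) => /eqP.
  apply/matrixP => j k; rewrite (ord1 k) tensor_apply_clique 1?ltnW // !mxE.
  rewrite -rmorphXn -rmorphM -Ax /link_sum rmorph_sum /=.
  apply: eq_bigr => S _; rewrite rmorph_prod /=.
  by apply: eq_bigr => l _; rewrite mxE.
by apply/complexI; rewrite normc_norm ger0_norm // lecR.
Qed.

End CliqueSpectralRadius.

(** * The inequality and the regular case *)

Theorem theorem1p4 (R : realType) (r : nat) (hr : (2 <= r)%N)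
    (n : nat) (G : sgraph n) :
  ((num_cliques G r)%:R <= n%:R / r%:R * clique_spectral_radius R G r) /\
  ((forall i j : 'I_n, num_cliques_at G r i = num_cliques_at G r j) ->
   (num_cliques G r)%:R = n%:R / r%:R * clique_spectral_radius R G r).
Proof.
have r0 : (0 < r)%N := ltnW hr.
have handshake := sum_degree (@cliques_card n G r).
(* Without vertices there is no clique of positive size, and the factor [n%:R / r%:R] is 0, whatever
   the value of the supremum. *)
have [n_eq0 | n0] := posnP n.
  have c0 : num_cliques G r = 0%N.
    apply/eqP; rewrite -(eqn_pmul2l r0) muln0 -handshake big1 // => i.
    by have /gtn_eqF/eqP/(_ n_eq0) := leq_ltn_trans (leq0n i) (ltn_ord i).
  have nR0 : n%:R = 0 :> R by rewrite n_eq0.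
  by rewrite c0 nR0 !mul0r.
have [s As cs] := exists_large_clique_modulus R G n0 hr.
have le_radius :
    (num_cliques G r)%:R <= n%:R / r%:R * clique_spectral_radius R G r.
  apply: le_trans cs _; rewrite ler_wpM2l ?divr_ge0 //.
  (* A supremum dominates its set only when that set is bounded; the total number of cliques bounds
     every degree, hence every modulus. *)
  apply: ub_le_sup => //; exists (#|cliques G r|)%:R.
  apply: clique_eigenvalue_moduli_ub => // i.
  by apply/subset_leq_card/fintype.subsetP => S; rewrite inE => /andP[].
split=> // regular; apply/le_anti; rewrite le_radius /=.
pose d := num_cliques_at G r (Ordinal n0).
(* Double counting gives [n * d = r * num_cliques G r], so the remaining inequality reduces to a
   spectral radius of at most [d]. *)
have -> : (num_cliques G r)%:R = n%:R / r%:R * d%:R :> R.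
  have : (n * d = r * num_cliques G r)%N.
    rewrite -handshake (eq_bigr (fun=> d)) ?sum_nat_const ?card_ord // => i _.
    exact: regular.
  move/(congr1 (fun k => k%:R : R)); rewrite !natrM mulrAC => ->.
  by rewrite mulrC mulKf // pnatr_eq0 -lt0n.
rewrite ler_wpM2l ?divr_ge0 //; apply: ge_sup; first by exists s.
by apply: clique_eigenvalue_moduli_ub => // i; rewrite (regular i (Ordinal n0)).
Qed.
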